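(* For every odd $n\in\mathbb{Z}_{>0}$ there exist a graph $G=(V,E)$ on $n$ vertices and a family $\mathcal{F}$ of facets of $P^{\uparrow}_{\mathrm{odd}}(G)$ whose size is exponential in $n$, with the following property: for every $F\in\mathcal{F}$ and all $a\in\mathbb{Z}^E$, $b\in\mathbb{Z}$ such that $F=\{x\in P^{\uparrow}_{\mathrm{odd}}(G)\colon a^\top x=b\}$, we have \[ \max_{e\in E}|a_e|\ \ge\ n-4\qquad\text{and}\qquad\bigl|\{a_e\colon e\in E\}\bigr|\ \ge\ \frac{n-3}{2}\,. \]
   Context: For a graph $G=(V,E)$, the odd cycle polytope is $P_{\mathrm{odd}}(G)=\operatorname{conv}\{\chi^C\colon C\subseteq E \text{ an odd cycle of } G\}$ (with $\chi^C$ the incidence vector), and its dominant is the Minkowski sum $P^{\uparrow}_{\mathrm{odd}}(G)=P_{\mathrm{odd}}(G)+\mathbb{R}^E_{\ge0}$. *)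

(* Defs.v *)
From HB Require Import structures.
From mathcomp Require Import all_boot all_order all_algebra.
From mathcomp Require Import reals.
Set Implicit Arguments. Unset Strict Implicit. Unset Printing Implicit Defensive.
Import Order.TTheory GRing.Theory Num.Theory.
Local Open Scope ring_scope.

Definition simple_graph (n : nat) (E : {set {set 'I_n}}) : Prop :=
  forall e, e \in E -> #|e| = 2%N.

(* The edges of the graph, as a finite index type: R^E = (edge E -> R). *)
Definition edge (n : nat) (E : {set {set 'I_n}}) : finType :=
  {e : {set 'I_n} | e \in E}.

Definition is_odd_cycle (n : nat) (E C : {set {set 'I_n}}) : Prop :=
  exists s : seq 'I_n,
    [/\ uniq s, (3 <= size s)%N, odd (size s),
        C = [set [set x; next s x] | x in s] & C \subset E].

Section Polyhedra.
Variable R : realFieldType.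
Variable I : finType.

Definition conv (S : (I -> R) -> Prop) (x : I -> R) : Prop :=
  exists (k : nat) (p : 'I_k -> I -> R) (l : 'I_k -> R),
    [/\ forall i, S (p i), forall i, 0 <= l i, \sum_i l i = 1
      & forall e, x e = \sum_i l i * p i e].

(* Minkowski sum S + R^I_{>=0} *)
Definition dominant (S : (I -> R) -> Prop) (x : I -> R) : Prop :=
  exists y, S y /\ forall e, y e <= x e.

Definition aff_indep (k : nat) (p : 'I_k -> I -> R) : Prop :=
  forall l : 'I_k -> R, \sum_i l i = 0 ->
    (forall e, \sum_i l i * p i e = 0) -> forall i, l i = 0.

Definition has_aff_indep (S : (I -> R) -> Prop) (k : nat) : Prop :=
  exists p : 'I_k -> I -> R, (forall i, S (p i)) /\ aff_indep p.

Definition dim_eq (S : (I -> R) -> Prop) (d : nat) : Prop :=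
  has_aff_indep S d.+1 /\ ~ has_aff_indep S d.+2.

Definition is_face (F P : (I -> R) -> Prop) : Prop :=
  exists (a : I -> R) (b : R),
    (forall x, P x -> b <= \sum_e a e * x e) /\
    (forall x, F x <-> P x /\ \sum_e a e * x e = b).

Definition is_facet (F P : (I -> R) -> Prop) : Prop :=
  is_face F P /\ exists d, dim_eq P d.+1 /\ dim_eq F d.

End Polyhedra.

Definition incid (R : realFieldType) (n : nat) (E C : {set {set 'I_n}})
  (e : edge E) : R := if val e \in C then 1 else 0.

Definition P_odd (R : realFieldType) (n : nat) (E : {set {set 'I_n}}) :
  (edge E -> R) -> Prop :=
  @conv R (edge E) (fun y => exists C, is_odd_cycle E C /\ y = incid R C).

Definition P_odd_up (R : realFieldType) (n : nat) (E : {set {set 'I_n}}) :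
  (edge E -> R) -> Prop := @dominant R (edge E) (@P_odd R n E).

Arguments P_odd R {n} E _.
Arguments P_odd_up R {n} E _.

(* Main.v *)
Require Import Defs.
From HB Require Import structures.
From mathcomp Require Import all_boot all_order all_algebra.
From mathcomp Require Import reals.
From mathcomp Require Import boolp zify ring lra.
Set Implicit Arguments. Unset Strict Implicit. Unset Printing Implicit Defensive.
Import Order.TTheory GRing.Theory Num.Theory.
Local Open Scope ring_scope.

(* Take G = K_n with n = 2k+3. Put N = 2k+1 vertices on a cycle (the rim) and
   call the two others p and q. Weight a pair of rim vertices by the length of
   the odd arc between them, a pair {p,i} or {q,i} by k, and {p,q} by 1.
   Every triangle xyz satisfies w(xy) + w(yz) + w(xz) >= N and
   w(xz) + w(yz) <= N + w(xy), which by induction along walks gives weight at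
   least N to every odd closed walk.
   If z vanishes on all odd cycles of weight N, then the triangles on p or q and
   a rim edge, together with the oddness of the rim, give z(pi) = z(qi); with
   the triangles pqi, all rim edges get the value z(pq); the rim itself makes
   it 0; the cycles made of a chord and its even arc, and some triangles, kill
   the chords. So w(x) >= N defines a facet, whose integral equations are the
   multiples of w, and w takes all the values 1, 3, ..., N-2 = n-4.
   Relabelling the vertices by swapping any of about k/2 disjoint pairs of
   consecutive rim vertices yields exponentially many facets. *)

(** * Linear dependence of finite families of vectors *)

Lemma lin_dependent (K : fieldType) (J : finType) k (p : 'I_k -> J -> K) :
  (#|J| < k)%N ->
  exists l : 'I_k -> K,
    (exists i, l i != 0) /\ forall j, \sum_i l i * p i j = 0.
Proof.
move=> Jk; pose B := \matrix_(i < k, j < #|J|) p i (enum_val j).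
have : kermx B != 0.
  rewrite kermx_eq0 /row_free; apply: contraTneq Jk => rB.
  by rewrite -leqNgt -{1}rB rank_leq_col.
move=> /rowV0Pn[v /sub_kermxP vB v0].
exists (v 0); split; first by apply/rV0Pn.
move=> j; have /rowP/(_ (enum_rank j)) := vB; rewrite !mxE => vBj.
rewrite -[RHS]vBj.
by apply: eq_bigr => i _; rewrite mxE enum_rankK.
Qed.

(** The matrix with rows [t j] has full column rank, since only the zero vector is orthogonal to all
    its rows; hence [#|I|] independent rows can be selected. *)
Lemma lin_indep_subfamily (K : fieldType) (I T : finType) (t : T -> I -> K) :
  (forall z : I -> K,
    (forall j, \sum_e z e * t j e = 0) -> forall e, z e = 0) ->
  exists f : 'I_#|I| -> T, forall l : 'I_#|I| -> K,
    (forall e, \sum_i l i * t (f i) e = 0) -> forall i, l i = 0.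
Proof.
move=> tspan.
pose A := \matrix_(j < #|T|, i < #|I|) t (enum_val j) (enum_val i).
have Afull : row_full A.
  rewrite /row_full -mxrank_tr -/(row_free A^T); apply: inj_row_free => v vA.
  apply/rowP => i; rewrite mxE -(enum_valK i).
  apply: (tspan (fun e => v 0 (enum_rank e))) => j.
  have /rowP/(_ (enum_rank j)) := vA; rewrite !mxE => vAj; rewrite -[RHS]vAj.
  rewrite (reindex_onto enum_rank enum_val) => [|e _]; last exact: enum_valK.
  rewrite [RHS](eq_bigl (fun=> true)); last by move=> e; rewrite enum_rankK eqxx.
  by apply: eq_bigr => e _; rewrite !mxE !enum_rankK.
exists (fun i => enum_val (fullrankfun Afull i)) => l l0 i.
pose v := \row_i l i.
have : v *m rowsub (fullrankfun Afull) A = 0 *m rowsub (fullrankfun Afull) A.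
  rewrite mul0mx; apply/rowP => e; rewrite !mxE -[RHS](l0 (enum_val e)).
  by apply: eq_bigr => j _; rewrite !mxE.
by move=> /(row_free_inj (fullrowsub_free Afull))/rowP/(_ i); rewrite !mxE.
Qed.

(** * Facets of an up-closed set from a spanning family of tight points *)

Section TightFamily.
Variables (R : realFieldType) (I T : finType) (P : (I -> R) -> Prop).
Variables (w : I -> R) (N : R) (t : T -> I -> R).
Hypothesis P_up : forall x y : I -> R, P x -> (forall e, x e <= y e) -> P y.
Hypothesis P_ge : forall x, P x -> N <= \sum_e w e * x e.
Hypothesis N_gt0 : 0 < N.
Hypothesis tP : forall j, P (t j).
Hypothesis t_tight : forall j, \sum_e w e * t j e = N.
Hypothesis t_span : forall z : I -> R,
  (forall j, \sum_e z e * t j e = 0) -> forall e, z e = 0.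
Variable e0 : I.
Hypothesis w_ge0 : forall e, 0 <= w e.
Hypothesis w_e0 : 0 < w e0.

Let F x := P x /\ \sum_e w e * x e = N.

Let sum_combE k (l : 'I_k -> R) (p : 'I_k -> I -> R) :
  \sum_e w e * (\sum_i l i * p i e) = \sum_i l i * \sum_e w e * p i e.
Proof.
under eq_bigr => e _ do rewrite mulr_sumr.
rewrite exchange_big /=; apply: eq_bigr => i _; rewrite mulr_sumr.
by apply: eq_bigr => e _; rewrite mulrCA.
Qed.

Let has_tight : exists j : T, True.
Proof.
have [j _|T0] := pickP (@predT T); first by exists j.
have /eqP : (1 : R) = 0.
  by apply: (t_span (z := fun=> 1) _ e0) => j; have := T0 j.
by rewrite oner_eq0.
Qed.

Let slack : exists2 x, P x & N < \sum_e w e * x e.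
Proof.
have [j _] := has_tight; exists (fun e => t j e + 1).
  by apply: P_up (tP j) _ => e; rewrite lerDl.
under eq_bigr => e _ do rewrite mulrDr mulr1.
rewrite big_split /= t_tight ltrDl (bigD1 e0) //=.
by rewrite ltr_wpDr // sumr_ge0.
Qed.

(** On [F] the functional [w] is constantly [N], which is nonzero, so every linear relation between
    points of [F] has coefficient sum 0. *)
Let no_indep_F : ~ has_aff_indep F #|I|.+1.
Proof.
move=> [p [pF pI]].
have [l [[i /eqP li] l0]] := lin_dependent p (ltnSn _).
apply/li/pI => //.
apply: (mulIf (lt0r_neq0 N_gt0)); rewrite mul0r mulr_suml.
transitivity (\sum_i l i * \sum_e w e * p i e).
  by apply: eq_bigr => i' _; rewrite (pF i').2.
by rewrite -sum_combE big1 // => e _; rewrite l0 mulr0.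
Qed.

Lemma tight_family_facet : is_facet F P.
Proof.
have [f f_indep] := lin_indep_subfamily t_span.
split; first by exists w, N.
have I_gt0 : (0 < #|I|)%N by apply/card_gt0P; exists e0.
exists #|I|.-1; rewrite /dim_eq prednK //.
split; split => //; last 1 first.
- exists (fun i => t (f i)); split; first by move=> i; split.
  by move=> l _; apply: f_indep.
- have [x xP xN] := slack.
  exists (fun i => if unlift ord0 i is Some j then t (f j) else x); split.
    by move=> i; case: unliftP.
  move=> l; rewrite big_ord_recl => l_sum l0.
  have l0E e : l ord0 * x e + \sum_i l (lift ord0 i) * t (f i) e = 0.
    rewrite -[RHS](l0 e) big_ord_recl unlift_none; congr (_ + _).
    by apply: eq_bigr => i _; rewrite liftK.
  (* Pairing the relation with [w] isolates the coefficient of [x], the only point whose value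
     differs from [N]. *)
  have lx : l ord0 = 0.
    have : l ord0 * (\sum_e w e * x e)
         + \sum_i l (lift ord0 i) * \sum_e w e * t (f i) e = 0.
      rewrite -sum_combE mulr_sumr -big_split big1 //= => e _.
      by rewrite mulrCA -mulrDr l0E mulr0.
    under [X in _ + X]eq_bigr => i _ do rewrite t_tight.
    rewrite -mulr_suml -(addr0_eq l_sum) mulNr -mulrBr => /eqP.
    by rewrite mulf_eq0 subr_eq0 (gt_eqF xN) orbF => /eqP.
  move=> i; case: (unliftP ord0 i) => [j|] -> //.
  apply: (f_indep (fun j => l (lift ord0 j))) => e.
  by rewrite -[RHS](l0E e) lx mul0r add0r.
- move=> [p [_ pI]].
  (* The extra coordinate [None], constantly 1, encodes that the coefficients sum to 0. *)
  have [l [[i /eqP li] l0]] :=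
    @lin_dependent _ (option I) _
      (fun i o => if o is Some e then p i e else 1)
      ltac:(by rewrite card_option).
  apply/li/pI; first by rewrite -[RHS](l0 None); apply: eq_bigr => ?; rewrite mulr1.
  by move=> e; exact: (l0 (Some e)).
Qed.

(** [N * a - b * w] vanishes on every tight point, hence everywhere. If [b] were 0, then [a] would
    be 0 and the slack point would lie on the face. *)
Lemma tight_family_unique (a : I -> R) (b : R) :
  (forall x, F x <-> P x /\ \sum_e a e * x e = b) ->
  b != 0 /\ forall e, N * a e = b * w e.
Proof.
move=> FE.
have ab e : N * a e = b * w e.
  apply/eqP; rewrite -subr_eq0; apply/eqP.
  apply: (t_span (z := fun e => N * a e - b * w e)) => j.
  have /(proj1 (FE _))[_ atj] : F (t j) by split.
  under eq_bigr => e' _ do rewrite mulrBl -!mulrA.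
  by rewrite sumrB -!mulr_sumr atj t_tight mulrC subrr.
split=> //; apply/eqP => b0.
have a0 e : a e = 0.
  by apply: (mulfI (lt0r_neq0 N_gt0)); rewrite ab b0 mul0r mulr0.
have [x xP] := slack.
have /(proj2 (FE _))[_ ->] : P x /\ \sum_e a e * x e = b.
  by split=> //; rewrite b0 big1 // => e _; rewrite a0 mul0r.
by rewrite ltxx.
Qed.

End TightFamily.

(** * Weights on positions and lower bounds for odd closed walks *)

(** Of the two rim arcs, of lengths [d] and [2k+1-d], exactly one is odd; its length is taken. *)
Definition cdist (k d : nat) : nat := (if odd d then d else k.*2.+1 - d)%N.

(* Positions 0, ..., 2k lie on the rim; 2k+1 and 2k+2 stand for p and q. On the
   diagonal [wt] is 2k+1, the value for which the triangle inequalities below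
   also hold for repeated vertices. *)
Definition wt (k i j : nat) : nat :=
  (if (i <= k.*2) == (j <= k.*2) then cdist k ((i - j) + (j - i)) else k)%N.

Lemma wtC k i j : wt k i j = wt k j i.
Proof. by rewrite /wt eq_sym addnC. Qed.

Lemma wtxx k i : wt k i i = k.*2.+1.
Proof. by rewrite /wt eqxx subnn /cdist /= subn0. Qed.

Lemma wt_triangle k a b c : (0 < k)%N ->
  (a < k.*2.+3)%N -> (b < k.*2.+3)%N -> (c < k.*2.+3)%N ->
  (k.*2.+1 <= wt k a b + wt k b c + wt k a c)%N.
Proof. by rewrite /wt /cdist; do !case: ifP; lia. Qed.

Lemma wt_triangle_odd k a b c : (0 < k)%N ->
  (a < k.*2.+3)%N -> (b < k.*2.+3)%N -> (c < k.*2.+3)%N ->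
  (wt k a c + wt k b c <= k.*2.+1 + wt k a b)%N.
Proof. by rewrite /wt /cdist; do !case: ifP; lia. Qed.

Definition steps (T : Type) (x : T) (p : seq T) : seq (T * T) := zip (x :: p) p.

Lemma steps_cons (T : Type) (x y : T) p :
  steps x (y :: p) = (x, y) :: steps y p.
Proof. by []. Qed.

Lemma steps_map (T U : Type) (f : T -> U) x p :
  steps (f x) (map f p) = [seq (f c.1, f c.2) | c <- steps x p].
Proof. by elim: p x => //= y p IH x; rewrite !steps_cons IH. Qed.

Lemma steps_next (T : eqType) (x : T) p : uniq (x :: p) ->
  [seq (y, next (x :: p) y) | y <- x :: p] = steps x (rcons p x).
Proof.
suff H a : uniq (a :: p) ->
    [seq (y, next_at y x a p) | y <- a :: p] = steps a (rcons p x) by exact: H.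
elim: p a => [|b p IH] a; first by rewrite /= eqxx.
move=> /andP[ap bp]; rewrite rcons_cons steps_cons -IH //= eqxx; congr (_ :: _).
apply: (@eq_in_map _ _ _ _ (b :: p)).1 => y yp.
by rewrite ifN //; apply: contraNneq ap => <-.
Qed.

(** Prepending a step flips the parity: [wt_triangle] leads from odd to even walks,
    [wt_triangle_odd] from even to odd ones. *)
Lemma walk_ge k (x : nat) p : (0 < k)%N -> all (ltn^~ k.*2.+3) (x :: p) ->
  let S := (\sum_(c <- steps x p) wt k c.1 c.2)%N in
  if odd (size p) then (wt k x (last x p) <= S)%N
  else (k.*2.+1 <= S + wt k x (last x p))%N.
Proof.
move=> k0; elim: p x => [|y p IH] x /=; first by rewrite wtxx leq_addl.
case/and3P => xn yn pn; rewrite steps_cons big_cons /=.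
have := IH y; rewrite /= yn pn => /(_ isT).
have ln : (last y p < k.*2.+3)%N.
  by move: (mem_last y p); rewrite inE => /predU1P[-> //|/(allP pn)].
have := wt_triangle k0 xn yn ln; have := wt_triangle_odd k0 xn yn ln.
by case: odd => /=; lia.
Qed.

(** This is an odd walk from [x] to [x], and the diagonal weight is [2k+1]. *)
Lemma closed_walk_ge k (x : nat) p : (0 < k)%N -> all (ltn^~ k.*2.+3) (x :: p) ->
  ~~ odd (size p) ->
  (k.*2.+1 <= \sum_(c <- steps x (rcons p x)) wt k c.1 c.2)%N.
Proof.
move=> k0 xpn op; have := @walk_ge k x (rcons p x) k0.
rewrite size_rcons /= op last_rcons wtxx; apply.
by rewrite all_rcons; move: xpn => /= /andP[-> ->].
Qed.

(** Serves the cycles made of consecutive rim positions and one closing edge. *)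
Lemma big_steps_iota (A : Type) (idx : A) (op : Monoid.law idx)
  (g : nat -> nat -> A) i m x :
  \big[op/idx]_(c <- steps i (rcons (iota i.+1 m) x)) g c.1 c.2 =
  op (\big[op/idx]_(i <= t < i + m) g t t.+1) (g (i + m)%N x).
Proof.
elim: m i => [|m IH] i /=.
  by rewrite steps_cons big_cons !big_nil addn0 big_geq // Monoid.mulm1 Monoid.mul1m.
rewrite steps_cons big_cons IH /= addSnnS Monoid.mulmA -big_ltn //; lia.
Qed.

(** * Functions on pairs of positions that vanish on all tight cycles *)

Section Span.
Variables (R : realFieldType) (k : nat) (h : nat -> nat -> R).
Hypothesis k_gt0 : (0 < k)%N.
Hypothesis hC : forall i j, h i j = h j i.
Hypothesis h0 : forall x p, uniq (x :: p) -> all (ltn^~ k.*2.+3) (x :: p) ->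
  (2 <= size p)%N -> ~~ odd (size p) ->
  (\sum_(c <- steps x (rcons p x)) wt k c.1 c.2 = k.*2.+1)%N ->
  \sum_(c <- steps x (rcons p x)) h c.1 c.2 = 0.

Let h_triangle a b c : uniq [:: a; b; c] -> all (ltn^~ k.*2.+3) [:: a; b; c] ->
  (wt k a b + wt k b c + wt k a c = k.*2.+1)%N -> h a b + h b c + h a c = 0.
Proof.
move=> U L W; have := h0 U L isT isT.
rewrite /= !steps_cons !big_cons !big_nil /= addn0 addr0 (hC c) addrA; apply.
by rewrite (wtC k c) addnA.
Qed.

Local Notation p := k.*2.+1.
Local Notation q := k.*2.+2.

(** Rim edges, smaller position first; the second disjunct closes the rim. *)
Let rim i j := [|| (j == i.+1) && (i < k.*2)%N | (i == 0%N) && (j == k.*2)].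

Let h_rim a i j : rim i j -> (a == p) || (a == q) ->
  h i j = - (h a i + h a j).
Proof.
move=> ij aP; suff : h a i + h i j + h a j = 0 by move=> H; lra.
by case/orP: aP => /eqP ->; apply: h_triangle => /=; rewrite ?inE;
  move: ij; rewrite /rim /wt /cdist; try lia; do !case: ifP; lia.
Qed.

Let h_hub i : (i <= k.*2)%N -> h p q = - (h p i + h q i).
Proof.
move=> ik; suff : h p q + h q i + h p i = 0 by move=> H; lra.
apply: h_triangle => /=; rewrite ?inE; try lia.
by rewrite /wt /cdist; do !case: ifP; lia.
Qed.

(* Going once around the rim, which has odd length, changes the sign of
   [h p i - h q i]. *)
Let h_spoke i : (i <= k.*2)%N -> h p i = h q i.
Proof.
have yS a b : rim a b -> h p b - h q b = - (h p a - h q a).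
  by move=> ab; have := h_rim ab (a := p); have := h_rim ab (a := q);
    rewrite !eqxx orbT => /(_ isT) -> /(_ isT) E; lra.
have y_sign j : (j <= k.*2)%N -> h p j - h q j = (-1) ^+ j * (h p 0 - h q 0).
  elim: j => [|j IH] jk; first by rewrite mul1r.
  rewrite (yS j) ?IH ?(ltnW jk) //; last by rewrite /rim eqxx jk.
  by rewrite exprS mulN1r mulNr.
have y0 : h p 0 - h q 0 = 0.
  have := yS 0%N k.*2; rewrite /rim !eqxx orbT => /(_ isT).
  by rewrite y_sign // -signr_odd odd_double => ?; lra.
by move=> ik; apply/eqP; rewrite -subr_eq0 y_sign // y0 mulr0.
Qed.

(** By [h_hub] and [h_spoke] every spoke has value minus half of [h p q], and a rim edge is minus
    the sum of two spokes. *)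
Let h_rimE i j : rim i j -> h i j = h p q.
Proof.
move=> ij; have /andP[ik jk] : (i <= k.*2)%N && (j <= k.*2)%N.
  by move: ij; rewrite /rim; lia.
rewrite (h_rim (a := p) ij) ?eqxx //.
by have := h_hub ik; have := h_hub jk; rewrite -!h_spoke // => ? ?; lra.
Qed.

(** The chord has weight [2k+1-2m], so with its arc of [2m] rim edges of weight 1 it forms a tight
    odd cycle. *)
Let h_even i m : (0 < m)%N -> (i + m.*2 <= k.*2)%N ->
  h i (i + m.*2)%N = - (h p q *+ m.*2).
Proof.
move=> m0 im; have := @h0 i (iota i.+1 m.*2).
rewrite size_iota odd_double (big_steps_iota _ (fun a b => h a b)).
rewrite (big_steps_iota _ (fun a b => wt k a b)) /= iota_uniq mem_iota ltnn /=.
rewrite (eq_big_nat _ _ (F2 := fun=> 1%N)) => [|t /andP[it tm]]; last first.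
  by rewrite /wt /cdist; do !case: ifP; lia.
rewrite (eq_big_nat _ _ (F2 := fun=> h p q)) => [|t /andP[it tm]]; last first.
  by apply: h_rimE; rewrite /rim; lia.
rewrite sum_nat_const_nat sumr_const_nat addKn muln1 (hC (i + _)%N) => H.
apply/eqP; rewrite -addr_eq0 addrC; apply/eqP; apply: H => //; last 2 first.
- lia.
- by rewrite /wt /cdist; do !case: ifP; lia.
apply/andP; split; first lia.
by apply/allP => t; rewrite mem_iota; lia.
Qed.

(** The chord from 0 to [2k] is itself a rim edge, so [h p q] equals [-2k] times itself. *)
Let h_axle : h p q = 0.
Proof.
have := @h_even 0 k k_gt0 (leqnn _).
rewrite h_rimE ?/rim ?eqxx ?orbT // => /eqP; rewrite -addr_eq0 -mulrS.
by rewrite mulrn_eq0 => /eqP.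
Qed.

Lemma wt_tight_span i j : (i < k.*2.+3)%N -> (j < k.*2.+3)%N -> i != j ->
  h i j = 0.
Proof.
wlog ij : i j / (i < j)%N => [IH|].
  move=> Li Lj ij; case: (ltngtP i j) => [lt|lt|/eqP]; [| |by rewrite (negPf ij)].
    exact: IH.
  by rewrite hC; apply: IH => //; rewrite eq_sym.
move=> _ jn _.
have spoke0 t : (t <= k.*2)%N -> h p t = 0 /\ h q t = 0.
  by move=> tk; have := h_hub tk; rewrite -h_spoke // h_axle => ?; lra.
have even0 s t : (s < t)%N -> (t <= k.*2)%N -> ~~ odd (t - s) -> h s t = 0.
  move=> st tk ost; have -> : t = (s + (t - s)./2.*2)%N by lia.
  by rewrite h_even ?h_axle ?mul0rn ?oppr0 //; lia.
have rim0 s : (s < k.*2)%N -> h s s.+1 = 0.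
  by move=> sk; rewrite h_rimE ?h_axle // /rim eqxx sk.
case: (leqP j k.*2) => jk; last first.
  case: (leqP i k.*2) => ik.
    have [hp hq] := spoke0 i ik; rewrite hC.
    by have [->|->] : j = p \/ j = q by lia.
  have -> : i = p by lia.
  have -> : j = q by lia.
  exact: h_axle.
case: (boolP (odd (j - i))) => dij; last exact: even0.
case: (ltnP j k.*2) => jlt.
  (* The triangle on [i], [j], [j+1] is tight, with one rim edge and one chord of even
     difference. *)
  suff : h i j + h j j.+1 + h i j.+1 = 0.
    by rewrite (rim0 j) // (even0 i j.+1) ?addr0 //; lia.
  apply: h_triangle => /=; rewrite ?inE; try lia.
  by rewrite /wt /cdist; do !case: ifP; lia.
(* Here [j] is [2k], so the triangle uses the predecessor of the smaller position instead; that
   position is not 0 because the difference is odd. *)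
case: i ij dij => [|i] ij dij; first by lia.
suff : h i i.+1 + h i.+1 j + h i j = 0.
  by rewrite (rim0 i) ?(even0 i j) ?add0r ?addr0 //; lia.
apply: h_triangle => /=; rewrite ?inE; try lia.
by rewrite /wt /cdist; do !case: ifP; lia.
Qed.

End Span.

(** * Cycles as edge sets in the complete graph *)

Lemma next_neq (T : eqType) (s : seq T) x : uniq s -> (2 <= size s)%N ->
  x \in s -> next s x != x.
Proof.
move=> us s2 /rot_to[i s' rs].
rewrite -(next_rot i us); move: us s2; rewrite -(rot_uniq i) -(size_rot i) rs.
by case: s' {rs} => //= y s' /andP[]; rewrite inE negb_or eqxx eq_sym => /andP[].
Qed.

Lemma next_next_neq (T : eqType) (s : seq T) x : uniq s -> (3 <= size s)%N ->
  x \in s -> next s (next s x) != x.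
Proof.
move=> us s3 /rot_to[i s' rs].
rewrite -!(next_rot i us); move: us s3; rewrite -(rot_uniq i) -(size_rot i) rs.
case: s' {rs} => [|y [|z s']] //= /and3P[]; rewrite !inE !negb_or eqxx.
by case/and3P => xy xz _ _ _ _; rewrite (eq_sym y) (negPf xy) eqxx eq_sym.
Qed.

(** Two vertices giving the same edge would be successors of each other, which a cycle of length at
    least three forbids. *)
Lemma cycle_edge_inj (T : finType) (s : seq T) : uniq s -> (3 <= size s)%N ->
  {in s &, injective (fun x => [set x; next s x])}.
Proof.
move=> us s3 x y xs ys /setP E; apply/eqP/negP => /negP xy.
have := E x; rewrite !inE eqxx (negPf xy) => /esym/= /eqP xE.
have := E y; rewrite !inE eqxx eq_sym (negPf xy) => /= /eqP yE.
by have := next_next_neq us s3 xs; rewrite -yE -xE eqxx.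
Qed.

Lemma big_cycle_edges (T : finType) (A : Type) (idx : A)
  (op : Monoid.com_law idx) (Z : {set T} -> A) x p :
  uniq (x :: p) -> (2 <= size p)%N ->
  \big[op/idx]_(c in [set [set y; next (x :: p) y] | y in x :: p]) Z c =
  \big[op/idx]_(c <- steps x (rcons p x)) Z [set c.1; c.2].
Proof.
move=> us s2; rewrite -steps_next // big_map.
by rewrite (big_imset _ (cycle_edge_inj us _)) //= big_uniq.
Qed.

Definition Kn n : {set {set 'I_n}} := [set e : {set 'I_n} | #|e| == 2%N].

Lemma cycle_sub_Kn n (s : seq 'I_n) : uniq s -> (2 <= size s)%N ->
  [set [set x; next s x] | x in s] \subset Kn n.
Proof.
move=> us s2; apply/subsetP => _ /imsetP[x xs ->].
by have := next_neq us s2 xs; rewrite inE cards2 eq_sym => ->.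
Qed.

Lemma sum_incid (R : realFieldType) n (E C : {set {set 'I_n}})
  (Z : {set 'I_n} -> R) : C \subset E ->
  \sum_(e : edge E) Z (val e) * incid R C e = \sum_(c in C) Z c.
Proof.
move=> CE; rewrite -(big_sub _ (fun c => Z c * (if c \in C then 1 else 0))).
rewrite (big_setID C) /= addrC big1 ?add0r => [|c /setDP[_ /negPf->]]; last first.
  by rewrite mulr0.
by rewrite (setIidPr CE); apply: eq_bigr => c ->; rewrite mulr1.
Qed.

(** * Transport of the weights to the edges of the complete graph *)

Section Weights.
Variables (R : realFieldType) (k : nat).
Local Notation n := k.*2.+3.
Local Notation N := k.*2.+1.

(* [s] sends a vertex to its position; both ordered pairs of distinct elements
   of an edge contribute the same value to the maximum. *)
Definition edge_wt (s : 'I_n -> 'I_n) (e : {set 'I_n}) : nat :=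
  \max_(x in e) \max_(y in e :\ x) wt k (s x) (s y).

Lemma edge_wt2 s x y : x != y -> edge_wt s [set x; y] = wt k (s x) (s y).
Proof.
move=> xy; rewrite /edge_wt big_setU1 ?big_set1 /= ?inE //.
rewrite setU1K ?inE // big_set1 setUC setU1K ?inE 1?eq_sym // big_set1.
by rewrite (wtC _ (s y)) maxnn.
Qed.

Lemma sum_edge_wt (s : 'I_n -> 'I_n) x p : uniq (x :: p) -> (2 <= size p)%N ->
  (\sum_(c in [set [set y; next (x :: p) y] | y in x :: p]) edge_wt s c =
   \sum_(c <- steps (val (s x)) (rcons [seq val (s y) | y <- p] (val (s x))))
     wt k c.1 c.2)%N.
Proof.
move=> U sp; rewrite big_cycle_edges // -(map_rcons (fun y => val (s y))).
rewrite (steps_map (fun y => val (s y))) big_map -steps_next // !big_map.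
apply: eq_big_seq => y yp; apply: edge_wt2.
by rewrite eq_sym; apply: next_neq yp => //; apply: ltnW.
Qed.

Lemma edge_wt_ge s C : (0 < k)%N -> is_odd_cycle (Kn n) C ->
  (N <= \sum_(c in C) edge_wt s c)%N.
Proof.
move=> k0 [[|x p]]; first by case.
case=> U sp op -> _; rewrite sum_edge_wt //.
apply: closed_walk_ge => //; last by rewrite size_map.
by apply/allP => _ /(@mapP _ _ (fun y => val (s y)) (x :: p))[y _ ->]; apply: ltn_ord.
Qed.

Lemma edge_wt_span s (z : edge (Kn n) -> R) : (0 < k)%N -> involutive s ->
  (forall C, is_odd_cycle (Kn n) C -> \sum_(c in C) edge_wt s c = N ->
    \sum_e z e * incid R C e = 0) -> forall e, z e = 0.
Proof.
move=> k0 sK z0.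
(* [Z] extends [z] by 0 to all vertex sets, and [v i] is the vertex at position [i], as [s] is its
   own inverse. Through them [z] becomes a symmetric function on pairs of positions. *)
pose Z c := if insub c is Some e then z e else 0.
have ZE e : Z (val e) = z e by rewrite /Z valK.
pose v i := s (inord i).
have sv i : (i < n)%N -> val (s (v i)) = i by move=> Li; rewrite /v sK /= inordK.
have vs x : v (val (s x)) = x by rewrite /v inord_val sK.
have h0 := @wt_tight_span R k (fun i j => Z [set v i; v j]) k0.
case=> e eK; rewrite -ZE /=; move: eK; rewrite inE => /cards2P[x [y [xy ->]]].
rewrite -(vs x) -(vs y); apply: h0 => [i j|a p U L sp op W| | |].
- by rewrite setUC.
- pose C := [set [set y; next (map v (a :: p)) y] | y in map v (a :: p)].
  have Uv : uniq (map v (a :: p)).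
    rewrite map_inj_in_uniq // => i j /(allP L) Li /(allP L) Lj vij.
    by rewrite -(sv i) // vij sv.
  have szv : (2 <= size (map v p))%N by rewrite size_map.
  have Codd : is_odd_cycle (Kn n) C.
    exists (map v (a :: p)); split=> //; rewrite ?size_map //.
    by rewrite cycle_sub_Kn //= size_map ltnW.
  have [_ [_ _ _ _ CK]] := Codd; have := z0 C Codd.
  have -> : \sum_e z e * incid R C e = \sum_(c in C) Z c.
    by rewrite -(sum_incid Z CK); apply: eq_bigr => e' _; rewrite ZE.
  rewrite /C sum_edge_wt // big_cycle_edges //.
  have /andP[La Lp] := L.
  have -> : [seq val (s y) | y <- map v p] = p.
    rewrite -map_comp -[RHS]map_id; apply/eq_in_map => i /(allP Lp) Li.
    exact: sv.
  rewrite sv // -(map_rcons v) steps_map big_map /=; exact.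
- exact: ltn_ord.
- exact: ltn_ord.
- by rewrite (inj_eq val_inj) (inj_eq (inv_inj sK)).
Qed.
End Weights.

(** * The facets given by the relabelled weights *)

Section KnFacets.
Variables (R : realFieldType) (k : nat).
Local Notation n := k.*2.+3.
Local Notation N := k.*2.+1.
Hypothesis k_gt0 : (0 < k)%N.

Lemma wt01 : wt k 0 1 = 1%N.
Proof. by rewrite /wt /cdist; do !case: ifP; lia. Qed.

Lemma edge_wt_ex (s : 'I_n -> 'I_n) i j : involutive s ->
  (i < n)%N -> (j < n)%N -> i != j ->
  exists e : edge (Kn n), edge_wt s (val e) = wt k i j.
Proof.
move=> sK Li Lj ij; pose x := s (inord i); pose y := s (inord j).
have xy : x != y by rewrite (inj_eq (inv_inj sK)) -val_eqE /= !inordK.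
have xyE : [set x; y] \in Kn n by rewrite inE cards2 xy.
by exists (Sub [set x; y] xyE : edge (Kn n)); rewrite /= edge_wt2 // !sK /= !inordK.
Qed.

Definition kn_face (s : 'I_n -> 'I_n) (x : edge (Kn n) -> R) : Prop :=
  P_odd_up R (Kn n) x /\ \sum_e (edge_wt s (val e))%:R * x e = N%:R.

Lemma incid_P_odd_up m (E C : {set {set 'I_m}}) : is_odd_cycle E C ->
  P_odd_up R E (incid R C).
Proof.
move=> EC; exists (incid R C); split=> //.
exists 1%N, (fun=> incid R C), (fun=> 1); split=> //.
- by move=> _; exists C.
- by rewrite big_ord1.
- by move=> e; rewrite big_ord1 mul1r.
Qed.

Lemma P_odd_up_ge m (E : {set {set 'I_m}}) (w : edge E -> R) (b : R) x :
  (forall e, 0 <= w e) ->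
  (forall C, is_odd_cycle E C -> b <= \sum_e w e * incid R C e) ->
  P_odd_up R E x -> b <= \sum_e w e * x e.
Proof.
move=> w0 wC [y [[r [p [l [pC l0 l1 yE]]]] yx]].
apply: (@le_trans _ _ (\sum_e w e * y e)); last first.
  by apply: ler_sum => e _; apply: ler_wpM2l.
under eq_bigr => e _ do rewrite yE mulr_sumr.
rewrite exchange_big /= -[b]mul1r -l1 mulr_suml; apply: ler_sum => i _.
under eq_bigr => e _ do rewrite mulrCA.
rewrite -mulr_sumr ler_wpM2l //.
by have [C [CE ->]] := pC i; apply: wC.
Qed.

Section Tight.
Variable s : 'I_n -> 'I_n.
Hypothesis sK : involutive s.

Let w (e : edge (Kn n)) : R := (edge_wt s (val e))%:R.

(** Boolean reflection turns the tight odd cycles into a finite index type. *)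
Let tight : finType := {C : {set {set 'I_n}} |
  `[< is_odd_cycle (Kn n) C /\ (\sum_(c in C) edge_wt s c = N)%N >]}.

Let t (C : tight) : edge (Kn n) -> R := incid R (val C).

Let w_incid C : is_odd_cycle (Kn n) C ->
  \sum_e w e * incid R C e = (\sum_(c in C) edge_wt s c)%N%:R.
Proof.
case=> p [_ _ _ _ CK].
by rewrite (sum_incid (fun c => (edge_wt s c)%:R) CK) natr_sum.
Qed.

Let tP (C : tight) : P_odd_up R (Kn n) (t C).
Proof. have /asboolP[CK _] := valP C; exact: incid_P_odd_up. Qed.

Let t_tight (C : tight) : \sum_e w e * t C e = N%:R.
Proof. by have /asboolP[CK CN] := valP C; rewrite /t w_incid ?CN. Qed.

Let t_span (z : edge (Kn n) -> R) :
  (forall C : tight, \sum_e z e * t C e = 0) -> forall e, z e = 0.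
Proof.
move=> z0; apply: (edge_wt_span k_gt0 sK) => C CK CN.
have tC : `[< is_odd_cycle (Kn n) C /\ (\sum_(c in C) edge_wt s c = N)%N >].
  exact/asboolP.
exact: (z0 (Sub C tC)).
Qed.

Let P_up (x y : edge (Kn n) -> R) :
  P_odd_up R (Kn n) x -> (forall e, x e <= y e) -> P_odd_up R (Kn n) y.
Proof.
by move=> [u [uP ux]] xy; exists u; split=> // e; apply: le_trans (xy e).
Qed.

Let P_ge x : P_odd_up R (Kn n) x -> N%:R <= \sum_e w e * x e.
Proof.
apply: P_odd_up_ge => [e|C CK]; first exact: ler0n.
by rewrite w_incid // ler_nat edge_wt_ge.
Qed.

Let w_ge0 e : 0 <= w e.
Proof. exact: ler0n. Qed.

Let w_unit : exists e, w e = 1.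
Proof.
have [e We] : exists e : edge (Kn n), edge_wt s (val e) = wt k 0 1.
  by apply: edge_wt_ex.
by exists e; rewrite /w We wt01.
Qed.

Lemma kn_face_facet : is_facet (kn_face s) (P_odd_up R (Kn n)).
Proof.
have [e0 we0] := w_unit.
apply: (tight_family_facet P_up P_ge _ tP t_tight t_span w_ge0 (e0 := e0)).
  by rewrite ltr0n.
by rewrite we0 ltr01.
Qed.

Lemma kn_face_unique (a : edge (Kn n) -> R) b :
  (forall x, kn_face s x <-> P_odd_up R (Kn n) x /\ \sum_e a e * x e = b) ->
  b != 0 /\ forall e, N%:R * a e = b * (edge_wt s (val e))%:R.
Proof.
have [e0 we0] := w_unit.
apply: (tight_family_unique P_up _ tP t_tight t_span w_ge0 (e0 := e0)).
  by rewrite ltr0n.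
by rewrite we0 ltr01.
Qed.

End Tight.

(** Both equations have right-hand side [N], so uniqueness up to scaling forces equal
    coefficients. *)
Lemma kn_face_inj s s' : involutive s ->
  (forall x, kn_face s x <-> kn_face s' x) ->
  forall e : edge (Kn n), edge_wt s (val e) = edge_wt s' (val e).
Proof.
move=> sK ss' e; have [_ /(_ e)] := kn_face_unique sK ss'.
by move=> /mulfI/eqP; rewrite pnatr_eq0 eqr_nat => /(_ isT)/eqP.
Qed.

(** An edge of weight 1 makes the scaling factor integral: it is the coefficient of [a] there. *)
Lemma kn_face_coeff s (a : edge (Kn n) -> int) (b : int) : involutive s ->
  (forall x, kn_face s x <->
     P_odd_up R (Kn n) x /\ \sum_e (a e)%:~R * x e = b%:~R) ->
  exists2 u : int, u != 0 & forall e, a e = u * (edge_wt s (val e))%:Z.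
Proof.
move=> sK /(kn_face_unique sK)[b0 ab].
have [e0 we0] : exists e : edge (Kn n), edge_wt s (val e) = wt k 0 1.
  by apply: edge_wt_ex.
rewrite wt01 in we0.
have abz e : N%:Z * a e = b * (edge_wt s (val e))%:Z.
  by apply: (@intr_inj R); rewrite !intrM ab.
exists (a e0) => [|e].
  apply: contraNneq b0 => a0; have := abz e0.
  by rewrite a0 mulr0 we0 mulr1 => <-.
apply: (@mulfI _ N%:Z) => //.
by rewrite (abz e) mulrA (abz e0) we0 mulr1.
Qed.

End KnFacets.

(** * Relabellings by swaps of disjoint pairs of rim vertices *)

Section Swap.
Variable h : nat.
Implicit Type B : {set 'I_h}.

(* Exchanges 2i+1 and 2i+2 for each i in B. *)
Definition swap_pairs B (x : nat) : nat :=
  if (0 < x)%N && [exists i in B, val i == x.-1./2]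
  then (if odd x then x.+1 else x.-1) else x.

Lemma swap_pairsK B : involutive (swap_pairs B).
Proof.
move=> x; rewrite {2}/swap_pairs; case: ifP => [/andP[x0 xB]|xB]; last first.
  by rewrite /swap_pairs xB.
rewrite /swap_pairs; case: (boolP (odd x)) => ox.
  have -> : x.+1.-1./2 = x.-1./2 by lia.
  by rewrite xB /= ox.
have -> : x.-1.-1./2 = x.-1./2 by lia.
by rewrite xB; do !case: ifP; lia.
Qed.

Lemma swap_pairs_lt B x n : (h.*2 < n)%N -> (x < n)%N -> (swap_pairs B x < n)%N.
Proof.
move=> hn xn; rewrite /swap_pairs; case: ifP => // /andP[x0].
by case/existsP => -[i ih] /andP[_ /eqP/= ix]; case: ifP; lia.
Qed.

Lemma swap_pairs_odd B (i : 'I_h) :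
  swap_pairs B i.*2.+1 = if i \in B then i.*2.+2 else i.*2.+1.
Proof.
rewrite /swap_pairs /= doubleK odd_double /=; congr (if _ then _ else _).
apply/existsP/idP => [[j /andP[jB /eqP/val_inj <-]] //|iB].
by exists i; rewrite iB eqxx.
Qed.

Definition swap_ord n B (x : 'I_n.+1) : 'I_n.+1 := inord (swap_pairs B x).

Lemma swap_ordE n B x : (h.*2 <= n)%N -> val (@swap_ord n B x) = swap_pairs B x.
Proof. by move=> hn; rewrite /= inordK // swap_pairs_lt. Qed.

Lemma swap_ordK n B : (h.*2 <= n)%N -> involutive (@swap_ord n B).
Proof.
by move=> hn x; apply: val_inj; rewrite !swap_ordE // swap_pairsK.
Qed.

(* The weight of the edge joining the fixed vertex 0 to the vertex 2i+1 tells
   whether i is in B: it is 2i+1 or 2k-1-2i. These agree only for 2i+1 = k,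
   which [h.*2 <= k] excludes. *)
Lemma swap_ord_wt_inj B B' k : (0 < k)%N -> (h.*2 <= k)%N ->
  (forall e : edge (Kn k.*2.+3),
     edge_wt (swap_ord B) (val e) = edge_wt (swap_ord B') (val e)) -> B = B'.
Proof.
move=> k0 hk BB'; apply/setP => i; have ih := ltn_ord i.
pose x : 'I_(k.*2.+3) := inord i.*2.+1.
have xE : val x = i.*2.+1 by rewrite /= inordK //; lia.
have x0 : ord0 != x by rewrite -val_eqE xE.
have xK : [set ord0; x] \in Kn k.*2.+3 by rewrite inE cards2 x0.
have := BB' (Sub [set ord0; x] xK); rewrite /= !edge_wt2 // !swap_ordE ?xE; try lia.
rewrite !swap_pairs_odd /swap_pairs /=.
by case: (i \in B) (i \in B') => [] [] //; rewrite /wt /cdist;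
  do !case: ifP; lia.
Qed.

End Swap.

(** * Size of the family and the final statement *)

(** With [h] the exponent of 2, [n <= 5h] holds from 27 on, and the fifth power of 11/10 is below
    2. *)
Lemma family_size (R : realFieldType) n : (27 <= n)%N ->
  (11 / 10 : R) ^+ n <= (2 ^ (n - 3)./2./2)%:R.
Proof.
move=> nN; set h := ((n - 3)./2./2)%N.
have hn : (n <= 5 * h)%N by rewrite /h; lia.
apply: (@le_trans _ _ ((11 / 10) ^+ (5 * h))).
  by apply: ler_weXn2l => //; lra.
by rewrite exprM natrX; apply: lerXn2r; rewrite ?nnegrE ?exprn_ge0 //; lra.
Qed.

Theorem theorem4 (R : realType) :
  exists c : R, 1 < c /\ exists N : nat,
  forall n : nat, (0 < n)%N -> odd n ->
  exists E : {set {set 'I_n}}, simple_graph E /\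
  exists (m : nat) (Fam : 'I_m -> (edge E -> R) -> Prop),
    [/\ (N <= n)%N -> c ^+ n <= m%:R,
        (forall i j, i <> j -> ~ (forall x, Fam i x <-> Fam j x)),
        (forall i, is_facet (Fam i) (P_odd_up R E))
      & forall i (a : edge E -> int) (b : int),
          (forall x, Fam i x <-> (P_odd_up R E x /\ \sum_e (a e)%:~R * x e = b%:~R)) ->
          (n%:R - 4 <= (\max_(e : edge E) `|a e|%N)%:R :> R) /\
          ((n%:R - 3) / 2 <= (size (undup [seq a e | e <- enum (edge E)]))%:R :> R)].
Proof.
exists (11 / 10); split; first by lra.
exists 27%N => n n0 on; exists (Kn n); split; first by move=> e; rewrite inE => /eqP.
have [nN|nN] := ltnP n 27.
  (* Below the threshold no size is demanded, so the empty family serves. *)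
  by exists 0%N, (fun i _ => False); split=> [//|[]|[]|[]].
pose k := (n - 3)./2; have nk : n = k.*2.+3 by rewrite /k; lia.
have k0 : (0 < k)%N by rewrite /k; lia.
have size_ok := family_size R nN; rewrite -/k in size_ok.
move: k nk k0 size_ok => k -> k0 size_ok {n n0 on nN}.
have hk : (k./2.*2 <= k)%N by lia.
have sK (B : {set 'I_(k./2)}) : involutive (@swap_ord _ k.*2.+2 B).
  by apply: swap_ordK; lia.
exists #|{: {set 'I_(k./2)}}|, (fun i => kn_face (swap_ord (enum_val i))).
split=> [_|i j ij FE|i|i a b Fab].
- by rewrite -cardsT -powersetT card_powerset cardsT card_ord.
- apply/ij/enum_val_inj/(swap_ord_wt_inj k0 hk).
  exact: (kn_face_inj k0 (sK _) FE).
- exact: kn_face_facet.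
have [u u0 aE] := kn_face_coeff k0 (sK _) Fab.
split.
  (* Positions 0 and 2 are joined by an edge of weight [2k-1], which is [n-4]. *)
  have [e we] := @edge_wt_ex k _ 0 2 (sK (enum_val i)) isT isT isT.
  have := @leq_bigmax _ (fun e => `|a e|%N) e.
  rewrite aE we -(@ler_nat R); apply: le_trans.
  have wt2 : (wt k 0 2 = k.*2.-1)%N.
    by rewrite /wt /cdist; do !case: ifP; lia.
  rewrite abszM absz_nat wt2 natrM.
  rewrite (_ : _ - 4 = 1 * k.*2.-1%:R) ?ler_wpM2r ?ler0n ?ler1n ?absz_gt0 //.
  by rewrite mul1r; apply/eqP; rewrite subr_eq -natrD eqr_nat; lia.
rewrite (_ : _ / 2 = k%:R); last first.
  by rewrite (_ : k.*2.+3 = k * 2 + 3)%N ?natrD ?natrM; [field|lia].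
(* The [k] distinct values [u * (2j+1)] for [j < k] all occur, on the edges joining positions 0 and
   [2j+1]. *)
rewrite ler_nat -[k in (k <= _)%N](size_iota 0) -(size_map (fun i => u * (i.*2.+1)%:Z)).
apply: uniq_leq_size.
  by rewrite map_inj_uniq ?iota_uniq // => p q /(mulfI u0) []; lia.
move=> _ /mapP[j jk ->]; rewrite mem_iota /= in jk; rewrite mem_undup.
have [||e we] := @edge_wt_ex k _ 0 j.*2.+1 (sK (enum_val i)) isT; [lia|by []|].
apply/mapP; exists e; first by rewrite mem_enum.
rewrite aE we; congr (_ * Posz _).
by rewrite /wt /cdist; do !case: ifP; lia.
Qed.
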